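(* Let $G$ and $H$ be simple graphs. Then the number of perfect matchings of $G\triangledown H$ is $$m(G\triangledown H)=\langle \mu^+_{\bar G},\mu^+_{\bar H}\rangle=\frac{1}{\sqrt{2\pi}}\int_{-\infty}^{\infty}e^{-t^2/2}\,\mu^+_{\bar G}(t)\,\mu^+_{\bar H}(t)\,dt .$$
   Context: Graphs are finite, without loops or multiple edges. $\bar G$ is the complement of $G$. The join $G\triangledown H$ is the disjoint union of $G$ and $H$ together with all edges between $V(G)$ and $V(H)$. $m(G)$ is the number of perfect matchings of $G$. A $k$-matching is a set of $k$ edges no two of which share a vertex; $m_k(G)$ is the number of $k$-matchings. For a graph with $n$ vertices, the signed matching polynomial is $\mu_G^+(t)=\sum_{0\le k\le n/2}(-1)^{k}m_k(G)t^{n-2k}$. The inner product on real polynomials is $\langle f,g\rangle=\frac{1}{\sqrt{2\pi}}\int_{-\infty}^{\infty}e^{-t^2/2}f(t)g(t)\,dt$. *)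

(* Defs.v *)
From mathcomp Require Import all_boot all_order all_algebra.
From mathcomp Require Import all_classical all_reals all_analysis.

Set Implicit Arguments.
Unset Strict Implicit.
Unset Printing Implicit Defensive.

Import Order.TTheory GRing.Theory Num.Theory.
Import numFieldNormedType.Exports.

Local Open Scope ring_scope.

Record sgraph := SGraph {
  vertex :> finType;
  adj : rel vertex;
  adj_sym : symmetric adj;
  adj_irr : irreflexive adj }.

Section Complement.
Variable G : sgraph.

Definition compl_adj : rel G := [rel x y | (x != y) && ~~ adj x y].

Lemma compl_adj_sym : symmetric compl_adj.
Proof. by move=> x y; rewrite /compl_adj /= eq_sym adj_sym. Qed.

Lemma compl_adj_irr : irreflexive compl_adj.
Proof. by move=> x; rewrite /compl_adj /= eqxx. Qed.

Definition gcompl : sgraph := SGraph compl_adj_sym compl_adj_irr.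
End Complement.

Section Join.
Variables G H : sgraph.

Definition join_adj : rel (G + H)%type := fun u v =>
  match u, v with
  | inl x, inl y => adj x y
  | inr x, inr y => adj x y
  | _, _ => true
  end.

Lemma join_adj_sym : symmetric join_adj.
Proof. by case=> x [] y //=; rewrite adj_sym. Qed.

Lemma join_adj_irr : irreflexive join_adj.
Proof. by case=> x /=; rewrite adj_irr. Qed.

Definition gjoin : sgraph := SGraph join_adj_sym join_adj_irr.
End Join.

Section Matchings.
Variable G : sgraph.

Definition edges : {set {set G}} :=
  [set e | [exists x, exists y, adj x y && (e == [set x; y])]].

Definition matching (M : {set {set G}}) : bool :=
  (M \subset edges) && finset.trivIset M.

Definition num_matchings (k : nat) : nat :=
  #|[set M : {set {set G}} | matching M & #|M| == k]|.

Definition num_perfect_matchings : nat :=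
  #|[set M : {set {set G}} | matching M & finset.cover M == [set: G]]|.
End Matchings.

Definition signed_matching_poly (R : realType) (G : sgraph) : {poly R} :=
  \sum_(k < (#|G|./2).+1)
    ((-1) ^+ k * (num_matchings G k)%:R) *: 'X^(#|G| - 2 * k).

(* [Rintegral] sends an infinite or undefined integral to a finite value; for
   polynomials f and g the integrand below is Lebesgue integrable. *)
Definition gauss_inner (R : realType) (f g : {poly R}) : R :=
  (Num.sqrt (2 * pi))^-1 *
  Rintegral (@lebesgue_measure R) setT
    (fun t : R => expR (- (t ^+ 2 / 2)) * f.[t] * g.[t]).

(* Main.v *)
Require Import Defs.
From HB Require Import structures.
From mathcomp Require Import all_boot all_order all_algebra.
From mathcomp Require Import all_classical all_reals all_analysis.
From mathcomp Require Import measurable_realfun zify ring lra.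
Import Order.TTheory GRing.Theory Num.Theory.
Import numFieldNormedType.Exports.
Local Open Scope ring_scope.
Set Implicit Arguments.
Unset Strict Implicit.
Unset Printing Implicit Defensive.

(* Integrating the derivative of [exp (- t^2 / 2) p(t)] over the line gives
   [E p' = E (X p)] for the standard Gaussian mean [E], so [E X^n] satisfies the
   recursion counting the ways to pair off [n] points. Hence, for a graph [K] and
   a matching [M] of its complement, [E X^(|K| - 2 |M|)] counts the pairings of
   the vertices of [K] that contain [M]; summing over [M] with the sign
   [(-1)^|M|], inclusion-exclusion leaves the pairings that avoid all edges of
   the complement, i.e. the perfect matchings of [K]. For [K] the join of [G]
   and [H], the complement of [K] is the disjoint union of the complements of
   [G] and [H], so its signed matching polynomial is the product of theirs. *)

(** * Gaussian moments of polynomials *)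

Section Gauss.
Local Open Scope classical_set_scope.
Context {R : realType}.
Implicit Types (p q : {poly R}) (t : R).
Local Notation mu := (@lebesgue_measure R).

Definition gauss_weight (t : R) : R := expR (- (t ^+ 2 / 2)).

(** The exponential series dominates each of its terms, here at [t ^+ 2 / 4]; the [1] pays for the
    passage from [|t| ^+ n] to its square. *)
Lemma norm_exprn_le_expR n t :
  `|t| ^+ n <= (1 + 4 ^+ n * n`!%:R) * expR (t ^+ 2 / 4).
Proof.
have t4 : 0 <= t ^+ 2 / 4 by rewrite divr_ge0// sqr_ge0.
have e1 : 1 <= expR (t ^+ 2 / 4).
  by rewrite (le_trans _ (expR_ge1Dx _))// lerDl.
apply: (@le_trans _ _ (1 + (t ^+ 2) ^+ n)).
  rewrite -[t ^+ 2]real_normK ?num_real// -exprM mulnC exprM.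
  have : 0 <= `|t| ^+ n by rewrite exprn_ge0.
  by move: (_ ^+ n) => a a0; nra.
rewrite mulrDl mul1r lerD//.
have -> : (t ^+ 2) ^+ n = 4 ^+ n * (t ^+ 2 / 4) ^+ n.
  by rewrite -exprMn mulrCA divff ?mulr1.
rewrite -mulrA ler_wpM2l ?exprn_ge0//.
case: n => [|n]; first by rewrite expr0 fact0 mul1r.
have := expR_ge1Dxn n t4.
have f0 : 0 < n.+1`!%:R :> R by rewrite ltr0n fact_gt0.
rewrite -ler_pdivrMl// mulrC; apply: le_trans.
by rewrite lerDr.
Qed.

(* Half of the Gaussian decay absorbs the polynomial, the other half gives
   integrability and vanishing at infinity. *)
Lemma gauss_weight_poly_bound p :
  exists2 C, 0 <= C & forall t, `|gauss_weight t * p.[t]| <= C * expR (- (t ^+ 2 / 4)).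
Proof.
exists (\sum_(i < size p) `|p`_i| * (1 + 4 ^+ i * i`!%:R)).
  by apply: sumr_ge0 => i _; rewrite mulr_ge0// addr_ge0// mulr_ge0// exprn_ge0.
move=> t.
have -> : gauss_weight t = expR (- (t ^+ 2 / 4)) * expR (- (t ^+ 2 / 4)).
  by rewrite -expRD; congr expR; field.
rewrite -mulrA normrM ger0_norm ?expR_ge0// mulrC ler_wpM2r ?expR_ge0//.
rewrite normrM ger0_norm ?expR_ge0// expRN ler_pdivrMl ?expR_gt0//.
rewrite horner_coef (le_trans (ler_norm_sum _ _ _))// mulr_sumr ler_sum// => i _.
rewrite normrM mulrCA normrX ler_wpM2l// mulrC.
exact: norm_exprn_le_expR.
Qed.

Lemma continuous_gauss_poly p : continuous (fun t => gauss_weight t * p.[t]).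
Proof.
move=> x; apply: cvgM; last exact: continuous_horner.
apply: (@continuous_comp _ _ _ (fun t : R => - (t ^+ 2 / 2)) expR);
  last exact: continuous_expR.
apply: cvgN; apply: cvgM; last exact: cvg_cst.
exact: exprn_continuous.
Qed.

Lemma measurable_gauss_poly p : measurable_fun setT (fun t => gauss_weight t * p.[t]).
Proof. apply: continuous_measurable_fun; exact: continuous_gauss_poly. Qed.

(** Up to a constant factor this is the density of the centred normal law of variance 2. *)
Lemma integrable_expR_sqr4 :
  mu.-integrable setT (EFin \o (fun t => expR (- (t ^+ 2 / 4)))).
Proof.
have s0 : Num.sqrt 2 != 0 :> R by rewrite gt_eqF// sqrtr_gt0.
have := @integrable_normal_pdf R 0 (Num.sqrt 2).
move/(integrableZl measurableT (normal_peak (Num.sqrt 2))^-1).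
apply: eq_integrable => //= t _.
rewrite normal_pdfE // /normal_fun -EFinM mulKf ?gt_eqF ?normal_peak_gt0//.
by rewrite subr0 sqr_sqrtr// mulNr; congr (expR (- (_ / _)))%:E; ring.
Qed.

Lemma integrable_gauss_poly p :
  mu.-integrable setT (EFin \o (fun t => gauss_weight t * p.[t])).
Proof.
have [C C0 hC] := gauss_weight_poly_bound p.
apply: (le_integrable measurableT _ _ (integrableZl measurableT C integrable_expR_sqr4)).
  by apply/measurable_EFinP; exact: measurable_gauss_poly.
move=> t _ /=; rewrite lee_fin (le_trans (hC t))//.
by rewrite ler_norm.
Qed.

Definition gauss_mean p : R :=
  (Num.sqrt (2 * pi))^-1 * Rintegral mu setT (fun t => gauss_weight t * p.[t]).

Lemma gauss_mean_is_linear : linear gauss_mean.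
Proof.
move=> a p q; rewrite /gauss_mean.
rewrite scalerAr -mulrDr; congr (_ * _).
under eq_Rintegral do rewrite hornerD hornerZ mulrDr mulrCA.
rewrite RintegralD//=; last exact: integrable_gauss_poly.
  by rewrite RintegralZl//; exact: integrable_gauss_poly.
have := integrableZl measurableT a (integrable_gauss_poly p).
exact: eq_integrable.
Qed.
HB.instance Definition _ :=
  GRing.isLinear.Build R {poly R} R *:%R gauss_mean gauss_mean_is_linear.

Lemma gauss_innerE p q : gauss_inner p q = gauss_mean (p * q).
Proof.
rewrite /gauss_inner /gauss_mean; congr (_ * _); apply: eq_Rintegral => t _.
by rewrite hornerM mulrA.
Qed.

Lemma gauss_mean1 : gauss_mean 1 = 1.
Proof.
have s1 : 1 != 0 :> R by [].
rewrite /gauss_mean -RintegralZl//; last exact: integrable_gauss_poly.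
transitivity (fine (\int[mu]_t (normal_pdf 0 1 t)%:E)); last by rewrite integral_normal_pdf.
congr fine; apply: eq_integral => t _.
rewrite normal_pdfE// /normal_fun /normal_peak hornerC mulr1 subr0.
by rewrite expr1n mul1r mulNr mulr_natl.
Qed.

Lemma is_derive_gauss_poly p t :
  is_derive t 1 (fun t => gauss_weight t * p.[t]) (gauss_weight t * (p^`() - 'X * p).[t]).
Proof.
(* With the exponent written as a polynomial, the derivative is inferred from those of [expR] and
   [horner]. *)
pose q : {poly R} := - ((2^-1)%:P * 'X^2).
have -> : (fun t => gauss_weight t * p.[t]) = (expR \o horner q) * horner p.
  apply/funext => x; rewrite /gauss_weight !fctE /= /q !hornerE.
  by congr (expR (- _) * _); rewrite /= expr2; field.
apply: is_derive_eq.
rewrite /q /= derivN derivM derivC mul0r add0r derivXn !hornerE /gauss_weight /=.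
have -> : 2^-1 * t * t = t ^+ 2 / 2 by field.
by rewrite /GRing.scale/=; field.
Qed.

Lemma integral_segment_deriv p (r : R) : 0 < r ->
  (\int[mu]_(t in `[(- r)%R, r]) (gauss_weight t * (p^`() - 'X * p).[t])%:E
  = (gauss_weight r * p.[r] - gauss_weight (- r) * p.[- r])%:E)%E.
Proof.
move=> r0; rewrite (@continuous_FTC2 _ _ (fun t => gauss_weight t * p.[t])) ?EFinB//.
- by rewrite gtrN.
- by apply: continuous_subspaceT => x; exact: continuous_gauss_poly.
- split => [x _||].
  + by case: (is_derive_gauss_poly p x).
  + by apply: cvg_at_right_filter; exact: continuous_gauss_poly.
  + by apply: cvg_at_left_filter; exact: continuous_gauss_poly.
- by move=> x _; rewrite derive1E; case: (is_derive_gauss_poly p x).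
Qed.

Lemma expR_sqr4_cvg0 : expR (- (x ^+ 2 / 4)) @[x --> +oo] --> (0 : R).
Proof.
apply: (cvg_comp (fun x : R => x ^+ 2 / 4) (fun x => expR (- x)));
  last exact: cvgr_expR.
by apply: gt0_cvgMly; [rewrite invr_gt0|exact: cvgr_expr2].
Qed.

(** The integrand is the derivative of [gauss_weight t * p.[t]], which vanishes at both ends of the
    line. *)
Lemma integral_gauss_deriv p :
  (\int[mu]_t (gauss_weight t * (p^`() - 'X * p).[t])%:E = 0)%E.
Proof.
set f := fun t : R => gauss_weight t * (p^`() - 'X * p).[t].
(* The shift [n.+1] keeps every segment nondegenerate, as [integral_segment_deriv] asks. *)
pose D (n : nat) : set R := `[- n.+1%:R, n.+1%:R]%classic.
have lim_int : (\int[mu]_(t in D n) (f t)%:E)%E @[n --> \oo] -->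
    (\int[mu]_t (f t)%:E)%E.
  under eq_cvg do rewrite integral_mkcond.
  apply: (@dominated_cvg _ _ R mu setT measurableT
    (fun n => (EFin \o f) \_ (D n)) (EFin \o f) (abse \o (EFin \o f))).
  - move=> n; apply/(@measurable_restrictT _ _ _ _ (D n) (EFin \o f)); first exact: measurable_itv.
    apply: measurable_funTS.
    by apply/measurable_EFinP; exact: measurable_gauss_poly.
  - move=> x _; apply: cvg_near_cst.
    near=> n; rewrite patchE ifT// inE /D /= in_itv /= -ler_norml.
    rewrite ltW// (lt_trans (truncnS_gt _))//.
    rewrite ltr_nat ltnS.
    near: n; exact: nbhs_infty_gt.
  - by [].
  - exact/integrable_abse/integrable_gauss_poly.
  - move=> n x _; rewrite patchE; case: ifP => //= _.
    by rewrite normr0 lee_fin.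
have [C C0 hC] := gauss_weight_poly_bound p.
(* Each of the two boundary terms is at most [C * expR (- (n.+1%:R ^+ 2 / 4))] in absolute value. *)
have lim0 : (\int[mu]_(t in D n) (f t)%:E)%E @[n --> \oo] --> (0 : \bar R)%E.
  under eq_cvg do rewrite integral_segment_deriv//.
  apply: cvg_EFin; first by apply: nearW.
  apply/norm_cvg0P.
  apply: (@squeeze_cvgr _ _ _ _ (cst 0) (fun n => 2 * C * expR (- (n.+1%:R ^+ 2 / 4)))).
  - apply: nearW => n; rewrite normr_ge0/= (le_trans (ler_normB _ _))//.
    rewrite -mulrA mulr2n mulrDl mul1r lerD//.
    by rewrite (le_trans (hC _))// sqrrN.
  - exact: cvg_cst.
  - rewrite -(mulr0 (2 * C)); apply: cvgM; first exact: cvg_cst.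
    apply: (@cvg_comp _ _ _ (fun n => n.+1%:R) (fun x : R => expR (- (x ^+ 2 / 4)))
      _ _ _ _ expR_sqr4_cvg0).
    by rewrite (cvg_shiftS (fun n => n%:R : R)); exact: cvgr_idn.
exact: (cvg_unique _ lim_int lim0).
Unshelve. all: by end_near.
Qed.

(** Integration by parts against the Gaussian weight (Stein's identity). *)
Lemma gauss_mean_deriv p : gauss_mean (p^`()) = gauss_mean ('X * p).
Proof.
apply/eqP; rewrite -subr_eq0 -linearB /= /gauss_mean /Rintegral.
by rewrite integral_gauss_deriv mulr0.
Qed.

Lemma gauss_meanX : gauss_mean 'X = 0.
Proof. by rewrite -['X]mulr1 -gauss_mean_deriv derivC raddf0. Qed.

(** The factor [n.+1] is the number of possible partners of one point among [n.+2], which matches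
    [card_pairings_rec]. *)
Lemma gauss_meanXSS n : gauss_mean 'X^(n.+2) = n.+1%:R * gauss_mean 'X^n.
Proof.
by rewrite exprS -gauss_mean_deriv derivXn -scaler_nat linearZ.
Qed.
End Gauss.

(** * Counting the pairings of a finite set *)

Section Pairings.
(* classical_sets shadows [trivIset], [cover], [set0], ... of finset. *)
Import mathcomp.boot.fintype mathcomp.boot.finset.
Context {T : finType}.
Implicit Types (A e : {set T}) (P M Q : {set {set T}}).

(** The perfect matchings of the complete graph on [A]. *)
Definition pairings A : {set {set {set T}}} :=
  [set P | [&& trivIset P, cover P == A & [forall e in P, #|e| == 2%N]]].

Lemma pairingsP A P :
  reflect [/\ trivIset P, cover P = A & {in P, forall e, #|e| = 2%N}]
          (P \in pairings A).
Proof.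
rewrite inE; apply: (iffP and3P) => [[tP /eqP cP /forall_inP P2]|[tP cP P2]].
  by split => // e /P2/eqP.
by split => //; [exact/eqP|apply/forall_inP => e /P2 ->].
Qed.

Lemma coverU P Q : cover (P :|: Q) = cover P :|: cover Q.
Proof. exact: bigcup_setU. Qed.

Lemma coverD P M : trivIset P -> M \subset P ->
  cover (P :\: M) = cover P :\: cover M.
Proof.
move=> /trivIsetP tP /subsetP MP; apply/setP => x; rewrite inE.
apply/bigcupP/andP => [[e /setDP[eP eM] xe]|[xM /bigcupP[e eP xe]]].
  split; last by apply/bigcupP; exists e.
  apply/bigcupP => -[f fM xf]; have := tP e f eP (MP f fM).
  have ef : e != f by apply: contraNneq eM => ->.
  by move=> /(_ ef)/disjointFr/(_ xe); rewrite xf.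
exists e => //; rewrite inE eP andbT; apply: contra xM => eM.
by apply/bigcupP; exists e.
Qed.

(** Deleting the blocks of [M] is a bijection onto the pairings of the remaining points; its inverse
    is union with [M]. *)
Lemma card_pairings_sup A M : trivIset M -> cover M \subset A ->
  {in M, forall e, #|e| = 2%N} ->
  #|[set P in pairings A | M \subset P]| = #|pairings (A :\: cover M)|.
Proof.
move=> tM MA M2.
rewrite -(card_in_imset (f := fun P => P :\: M)); last first.
  move=> P Q; rewrite !inE => /andP[_ MP] /andP[_ MQ] eqPQ.
  by rewrite -(setID P M) -(setID Q M) eqPQ (setIidPr MP) (setIidPr MQ).
congr #|pred_of_set _|; apply/setP => Q.
apply/imsetP/idP => [[P]|/pairingsP[tQ cQ Q2]].
  rewrite inE => /andP[/pairingsP[tP cP P2] MP ->].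
  apply/pairingsP; split; first exact: trivIsetD.
    by rewrite coverD// cP.
  by move=> e /setDP[/P2].
have dQM : [disjoint cover Q & cover M].
  by rewrite cQ -setI_eq0 setDE -setIA (setIC (~: _)) setICr setI0.
exists (Q :|: M).
  rewrite inE subsetUr andbT; apply/pairingsP; split.
  - exact: trivIsetU.
  - by rewrite coverU cQ setUC -[in RHS](setID A (cover M)) (setIidPr MA).
  - by move=> e /setUP[/Q2|/M2].
(* [Q] and [M] share no block: it would be nonempty and lie in two disjoint covers. *)
rewrite setDUl setDv setU0; apply/esym/setDidPl.
rewrite -setI_eq0; apply/eqP/setP => e; rewrite !inE.
apply/negP => /andP[eQ eM].
have /card_gt0P[x xe] : (0 < #|e|)%N by rewrite M2.
have xQ : x \in cover Q by apply/bigcupP; exists e.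
have xM : x \in cover M by apply/bigcupP; exists e.
by have := disjointFr dQM xQ; rewrite xM.
Qed.

Lemma pairings_set0 : pairings set0 = [set set0].
Proof.
apply/setP => P; rewrite inE [RHS]inE; apply/and3P/eqP => [[_ /eqP cP /forall_inP P2]|->].
  apply/eqP; rewrite -subset0; apply/subsetP => e eP.
  have /card_gt0P[x xe] : (0 < #|e|)%N by rewrite (eqP (P2 e eP)).
  have : x \in cover P by apply/bigcupP; exists e.
  by rewrite cP inE.
split; last by apply/forall_inP => e; rewrite inE.
  by apply/trivIsetP => e f; rewrite inE.
by rewrite /cover big_set0.
Qed.

(** Sorts the pairings by the partner [y] of [x]; once this pair is fixed, [card_pairings_sup]
    counts the rest. *)
Lemma card_pairings_rec A x : x \in A ->
  #|pairings A| = (\sum_(y in A :\ x) #|pairings (A :\: [set x; y])|)%N.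
Proof.
move=> xA.
transitivity (\sum_(P in pairings A) \sum_(y in A :\ x) ([set x; y] \in P : nat))%N.
  rewrite -sum1_card; apply: eq_bigr => P /pairingsP[tP cP P2].
  have xP : x \in cover P by rewrite cP.
  have xB : x \in pblock P x by rewrite mem_pblock.
  have B2 : #|pblock P x| = 2%N by exact/P2/pblock_mem.
  (* The partner of [x] is the one other point of its block. *)
  have -> : 1%N = #|pblock P x :\ x| by have := cardsD1 x (pblock P x); rewrite xB B2 => -[].
  rewrite -sum1_card big_mkcond [RHS]big_mkcond /=; apply: eq_bigr => y _.
  rewrite !inE; case: (eqVneq y x) => //= yx.
  have [eP|eP] := boolP ([set x; y] \in P).
    have -> : pblock P x = [set x; y] by apply: def_pblock; rewrite ?set21.
    rewrite set22 -cP (_ : y \in cover P)//.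
    by apply/bigcupP; exists [set x; y]; rewrite ?set22.
  rewrite if_same; case: ifP => // yB.
  case/negP: eP; suff -> : [set x; y] = pblock P x by exact: pblock_mem.
  apply/eqP; rewrite eqEcard cards2 eq_sym yx B2 andbT.
  by rewrite finset.subUset !sub1set xB yB.
rewrite exchange_big; apply: eq_bigr => y; rewrite !inE => /andP[yx yA].
rewrite -(cover1 [set x; y]) -card_pairings_sup; first last.
- by move=> e /set1P ->; rewrite cards2 eq_sym yx.
- by rewrite cover1 finset.subUset !sub1set xA.
- exact: trivIset1.
rewrite -sum1_card big_mkcond [RHS]big_mkcond /=; apply: eq_bigr => P _.
by rewrite [in RHS]in_set sub1set cover1; do 2 case: (_ \in _).
Qed.

(** Both sides satisfy the same recursion, which removes two points at a time; hence strong
    induction on [#|A|]. *)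
Lemma card_pairings {R : realType} A : #|pairings A|%:R = gauss_mean 'X^#|A| :> R.
Proof.
have [n] := ubnP #|A|; elim: n A => // n IHn A; rewrite ltnS => An.
have [->|[x xA]] := set_0Vmem A.
  by rewrite pairings_set0 cards0 cards1 expr0 gauss_mean1.
rewrite (card_pairings_rec xA) natr_sum.
move: (cardsD1 x A) An; rewrite xA add1n => -> An.
case cAx: #|A :\ x| An => [|m] An.
  (* A single point has no partner, and the first moment is zero. *)
  by rewrite expr1 gauss_meanX big_pred0// => y; rewrite (cards0_eq cAx) inE.
rewrite gauss_meanXSS (eq_bigr (fun=> gauss_mean 'X^m)) => [|y yAx].
  by rewrite sumr_const cAx mulr_natl.
have cA : #|A :\: [set x; y]| = m.
  have := cardsD1 y (A :\ x); rewrite yAx cAx -setDDl add1n => -[->].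
  by rewrite setDDl.
by rewrite IHn ?cA//; apply: leq_trans An.
Qed.

(** Expands the product of [(-1) + 1] over [P], where [M] records the factors that contribute
    [-1]. *)
Lemma sum_signed_subsets {R : realType} P :
  \sum_(M : {set {set T}} | M \subset P) (-1) ^+ #|M| = (P == set0)%:R :> R.
Proof.
transitivity (\prod_(e in P) ((-1) + 1 : R)); last first.
  have [->|[e eP]] := set_0Vmem P; first by rewrite big_set0 eqxx.
  rewrite (bigD1 e)//= addNr mul0r.
  by case: eqP => // P0; rewrite P0 inE in eP.
(* Sets outside [P] get the factor [0 + 1], so the product runs over all sets and only the choices
   [M \subset P] survive. *)
transitivity (\prod_e ((if e \in P then -1 else 0) + 1 : R)); last first.
  by rewrite [RHS]big_mkcond; apply: eq_bigr => e _; case: ifP => // _; rewrite add0r.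
rewrite bigA_distr big_mkcond /=; apply: eq_bigr => M _.
case: ifPn => [MP|/subsetPn[e eM eP]]; last first.
  by rewrite (bigD1 e)//= eM (negPf eP) mul0r.
rewrite -big_mkcond /= (eq_bigr (fun=> -1)) ?prodr_const// => e eM.
by rewrite (subsetP MP).
Qed.
End Pairings.

(** * Matchings of a graph and of its complement *)

Section Graphs.
Import mathcomp.boot.fintype mathcomp.boot.finset.
Implicit Types (G H K : sgraph).

Lemma edgesP {G} (e : {set G}) :
  reflect (exists x y, adj x y /\ e = [set x; y]) (e \in edges G).
Proof.
rewrite inE; apply: (iffP existsP) => [[x /existsP[y /andP[xy /eqP ->]]]|[x [y [xy ->]]]].
  by exists x, y.
by exists x; apply/existsP; exists y; rewrite xy eqxx.
Qed.

Lemma card_edge {G} (e : {set G}) : e \in edges G -> #|e| = 2%N.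
Proof.
move=> /edgesP[x [y [xy ->]]]; rewrite cards2; case: eqP => // eqxy.
by rewrite eqxy adj_irr in xy.
Qed.

Lemma edges_set2 {G} (x y : G) : ([set x; y] \in edges G) = adj x y.
Proof.
apply/edgesP/idP => [[u [v [uv /setP eq_uv]]]|xy]; last by exists x, y.
have /set2P xE : x \in [set u; v] by rewrite -eq_uv set21.
have /set2P yE : y \in [set u; v] by rewrite -eq_uv set22.
have /set2P uE : u \in [set x; y] by rewrite eq_uv set21.
have /set2P vE : v \in [set x; y] by rewrite eq_uv set22.
(* Equal pairs match their points only up to a swap, which [adj_sym] absorbs. *)
by case: xE yE uE vE => -> [] -> [] e [] f; rewrite // 1?adj_sym// -?e -?f// f e in uv *.
Qed.

Lemma imset_edges {G K} (f : G -> K) (e : {set G}) : injective f ->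
  {mono f : x y / adj x y} -> ([set f x | x in e] \in edges K) = (e \in edges G).
Proof.
move=> f_inj f_adj; apply/edgesP/edgesP => [[u [v [uv e_uv]]]|[x [y [xy ->]]]].
  have /imsetP[x _ ux] : u \in f @: e by rewrite e_uv set21.
  have /imsetP[y _ vy] : v \in f @: e by rewrite e_uv set22.
  move: uv e_uv; rewrite {}ux {}vy f_adj => xy e_xy.
  by exists x, y; split => //; apply: (imset_inj f_inj); rewrite e_xy imsetU1 imset_set1.
by exists (f x), (f y); rewrite f_adj imsetU1 imset_set1.
Qed.

Lemma edges_gcompl {G} (e : {set G}) :
  (e \in edges (gcompl G)) = (#|e| == 2%N) && (e \notin edges G).
Proof.
have [/cards2P[x [y [xy ->]]]|e2] /= := boolP (#|e| == 2%N).
  by rewrite (edges_set2 (G := gcompl G)) edges_set2 /= /compl_adj /= xy.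
by apply: contraNF e2 => /(@card_edge (gcompl G)) ->.
Qed.

Lemma matching_neq0 {G} (M : {set {set G}}) e :
  matching M -> e \in M -> e != set0.
Proof. by move=> /andP[/subsetP ME _] /ME/card_edge; rewrite -card_gt0 => ->. Qed.

Lemma card_cover_matching {G} (M : {set {set G}}) : matching M ->
  #|cover M| = (2 * #|M|)%N.
Proof.
move=> /andP[/subsetP ME /eqP <-].
by rewrite mulnC -sum_nat_const; apply: eq_bigr => e /ME/card_edge.
Qed.

Lemma card_setC_cover_matching {G} (M : {set {set G}}) : matching M ->
  #|~: cover M| = (#|G| - 2 * #|M|)%N.
Proof. by move=> mM; rewrite cardsCs setCK card_cover_matching. Qed.

Lemma leq_card_matching {G} (M : {set {set G}}) : matching M ->
  (2 * #|M| <= #|G|)%N.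
Proof. by move=> /card_cover_matching <-; exact: max_card. Qed.

(** Sorts the matchings by size; [inord] keeps the size intact because a matching has at most
    [#|G|./2] edges. *)
Lemma signed_matching_polyE {R : realType} G :
  signed_matching_poly R G =
  \sum_(M : {set {set G}} | matching M) (-1) ^+ #|M| *: 'X^(#|G| - 2 * #|M|).
Proof.
rewrite [RHS](partition_big (fun M : {set {set G}} => inord #|M| : 'I_(#|G|./2).+1) xpredT)//=.
apply: eq_bigr => k _.
rewrite (eq_bigl (fun M => M \in [set M : {set {set G}} | matching M & #|M| == k])).
  rewrite (eq_bigr (fun=> (-1) ^+ k *: 'X^(#|G| - 2 * k))) => [|M].
    by rewrite sumr_const scalerMnl mulr_natr.
  by rewrite inE => /andP[_ /eqP ->].
move=> M; rewrite !inE; apply: andb_id2l => /leq_card_matching leM.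
by rewrite -val_eqE /= inordK// ltnS geq_half_double -mul2n.
Qed.

(* Inclusion-exclusion over the edges of the complement used by a pairing of
   all the vertices. *)
Lemma perfect_matchings_gauss_mean {R : realType} K :
  (num_perfect_matchings K)%:R = gauss_mean (signed_matching_poly R (gcompl K)).
Proof.
pose E' := edges (gcompl K).
(* A pairing of all vertices is a perfect matching of [K] exactly when no block is an edge of the
   complement. *)
transitivity (\sum_(P in pairings [set: K]) (P :&: E' == set0)%:R : R).
  rewrite -natr_sum; congr _%:R; rewrite /num_perfect_matchings -sum1_card.
  rewrite big_mkcond [RHS]big_mkcond /=; apply: eq_bigr => P _.
  rewrite inE; case: (boolP (P \in _)) => [/pairingsP[tP cP P2]|PN].
    rewrite /matching tP cP eqxx !andbT.
    suff -> : (P \subset edges K) = (P :&: E' == set0) by case: ifP.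
    rewrite setI_eq0 disjoints_subset.
    apply/subsetP/subsetP => sP e eP; have := sP e eP;
      by rewrite in_setC /E' edges_gcompl P2// eqxx /= negbK.
  case: ifPn => // /andP[/andP[/subsetP sP tP] /eqP cP].
  case/negP: PN; apply/pairingsP; split => // e /sP; exact: card_edge.
rewrite signed_matching_polyE linear_sum /=.
(* [sum_signed_subsets] expands the indicator over [M \subset P :&: E']; such [M] are matchings,
   their blocks being disjoint already in [P]. *)
transitivity (\sum_(P in pairings [set: K])
    \sum_(M : {set {set K}} | matching (G := gcompl K) M)
      (if M \subset P then (-1) ^+ #|M| else 0 : R)).
  apply: eq_bigr => P /pairingsP[/trivIsetP tP _ _].
  rewrite -sum_signed_subsets big_mkcond [RHS]big_mkcond /=.
  apply: eq_bigr => M _; rewrite finset.subsetI.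
  have [MP|MP] /= := boolP (M \subset P); last by rewrite if_same.
  by rewrite /matching (trivIsetS MP) ?andbT//; exact/trivIsetP.
(* For fixed [M], the pairings containing it correspond to those of the vertices it leaves
   uncovered. *)
rewrite exchange_big; apply: eq_bigr => M mM.
rewrite linearZ /= -(card_setC_cover_matching (G := gcompl K) mM) -card_pairings.
rewrite -setTD -card_pairings_sup.
- rewrite -big_mkcondr /= sumr_const -[LHS]mulr_natr /GRing.scale /=; congr (_ * _%:R).
  by apply: eq_card => P; rewrite in_set unfold_in.
- by case/andP: mM.
- exact: finset.subsetT.
- by case/andP: mM => /subsetP ME _ e /ME/(@card_edge (gcompl K)).
Qed.
End Graphs.

(** * Matchings in the complement of a join *)

Section Join.
Import mathcomp.boot.fintype mathcomp.boot.finset.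
Variables (G H : sgraph).

Local Notation J := (gcompl (gjoin G H)).
Let iG (e : {set G}) : {set J} := [set inl x | x in e].
Let iH (e : {set H}) : {set J} := [set inr x | x in e].

Let inl_inj : injective (@inl G H). Proof. by move=> x y []. Qed.
Let inr_inj : injective (@inr G H). Proof. by move=> x y []. Qed.
Let iG_inj : injective iG. Proof. exact: imset_inj. Qed.
Let iH_inj : injective iH. Proof. exact: imset_inj. Qed.

Let iG_edges e : (iG e \in edges J) = (e \in edges (gcompl G)).
Proof.
apply: (@imset_edges (gcompl G) J inl e inl_inj) => x y.
by rewrite /= /compl_adj /= (inj_eq inl_inj).
Qed.

Let iH_edges e : (iH e \in edges J) = (e \in edges (gcompl H)).
Proof.
apply: (@imset_edges (gcompl H) J inr e inr_inj) => x y.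
by rewrite /= /compl_adj /= (inj_eq inr_inj).
Qed.

(** The join has every edge between the two sides, so its complement has none. *)
Let edges_join e : e \in edges J -> (exists f, e = iG f) \/ (exists f, e = iH f).
Proof.
move=> /edgesP[[x|x] [[y|y] [//= xy ->]]].
- by left; exists [set x; y]; rewrite /iG imsetU1 imset_set1.
- by right; exists [set x; y]; rewrite /iH imsetU1 imset_set1.
Qed.

Definition glue (M : {set {set G}} * {set {set H}}) : {set {set J}} :=
  [set iG e | e in M.1] :|: [set iH e | e in M.2].

Definition unglue (M : {set {set J}}) : {set {set G}} * {set {set H}} :=
  ([set e | iG e \in M], [set e | iH e \in M]).

(* The empty set lies in the image of both embeddings, so gluing is only
   invertible on families of nonempty sets. *)
Let iG_neq_iH e f : e != set0 -> iG e != iH f.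
Proof.
move=> /set0Pn[x xe]; apply/eqP => /setP/(_ (inl x)).
by rewrite imset_f// => /esym/imsetP[].
Qed.

Let iG_notin (M : {set {set H}}) f : f != set0 -> iG f \notin [set iH e | e in M].
Proof. by move=> f0; apply/imsetP => -[e _ /eqP]; apply/negP/iG_neq_iH. Qed.

(** Both conditions can be tested on each side, since blocks from different sides never meet. *)
Lemma matching_glue M :
  matching (glue M) = matching (G := gcompl G) M.1 && matching (G := gcompl H) M.2.
Proof.
case: M => MG MH; rewrite /matching /glue /= finset.subUset andbACA.
have -> : ([set iG e | e in MG] \subset edges J) = (MG \subset edges (gcompl G)).
  apply/subsetP/subsetP => [sM e eM|sM _ /imsetP[e eM ->]]; last by rewrite iG_edges sM.
  by rewrite -iG_edges sM// imset_f.
have -> : ([set iH e | e in MH] \subset edges J) = (MH \subset edges (gcompl H)).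
  apply/subsetP/subsetP => [sM e eM|sM _ /imsetP[e eM ->]]; last by rewrite iH_edges sM.
  by rewrite -iH_edges sM// imset_f.
congr (_ && _); rewrite -(imset_trivIset MG inl_inj) -(imset_trivIset MH inr_inj).
apply/idP/andP => [tM|[tG tH]].
  by split; apply: trivIsetS tM; [exact: finset.subsetUl|exact: finset.subsetUr].
apply: trivIsetU => //; rewrite !cover_imset -setI_eq0.
apply/eqP/setP => u; rewrite !inE; apply/negP.
by move=> /andP[/bigcupP[e _ /imsetP[x _ ->]] /bigcupP[f _ /imsetP[]]].
Qed.

(** No block comes from both sides, as the blocks of [M.1] are nonempty. *)
Lemma card_glue M : matching (G := gcompl G) M.1 ->
  #|glue M| = (#|M.1| + #|M.2|)%N.
Proof.
move=> mG; rewrite -(card_imset _ iG_inj) -(card_imset _ iH_inj) -cardsUI.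
rewrite [_ :&: _](_ : _ = set0) ?cards0 ?addn0//.
apply/setP => e; rewrite !inE; apply/negP => /andP[/imsetP[f fM ->]].
by apply/negP/iG_notin/(matching_neq0 (G := gcompl G) mG fM).
Qed.

Lemma glueK M : matching (G := gcompl G) M.1 -> matching (G := gcompl H) M.2 ->
  unglue (glue M) = M.
Proof.
case: M => MG MH /= mG mH; congr pair; apply/setP => e; rewrite in_set.
  apply/setUP/idP => [[|]|eM]; last by left; rewrite imset_f.
    by rewrite mem_imset.
  (* Here [e] is arbitrary and may be empty; then a block of [MH] would have an empty image, though
     it is nonempty. *)
  have [->|e0] := eqVneq e set0; last by rewrite (negPf (iG_notin _ e0)).
  move=> /imsetP[f fM /setP f0]; have /set0Pn[y yf] := matching_neq0 (G := gcompl H) mH fM.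
  by have := f0 (inr y); rewrite /iG imset0 inE imset_f.
apply/setUP/idP => [[|]|eM]; last by right; rewrite imset_f.
  move=> /imsetP[f fM /esym/eqP].
  by rewrite (negPf (iG_neq_iH _ (matching_neq0 (G := gcompl G) mG fM))).
by rewrite mem_imset.
Qed.

Lemma unglueK M : matching M -> glue (unglue M) = M.
Proof.
move=> /andP[/subsetP ME _]; apply/setP => e; apply/setUP/idP => [[]/imsetP[f]|eM].
- by rewrite inE => ? ->.
- by rewrite inE => ? ->.
case: (edges_join (ME e eM)) => -[f ef]; [left|right]; apply/imsetP; exists f => //;
  by rewrite inE -ef.
Qed.

(** Along the bijection [glue] vertex counts and matching sizes add, so the signed monomials
    multiply. *)
Lemma signed_matching_poly_join {R : realType} :
  signed_matching_poly R (gcompl G) * signed_matching_poly R (gcompl H) =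
  signed_matching_poly R J.
Proof.
rewrite !signed_matching_polyE.
rewrite [RHS](reindex_onto glue unglue); last by move=> M; exact: unglueK.
rewrite big_distrlr pair_big /=.
apply: eq_big => [M|M /andP[mG mH]].
  rewrite matching_glue; case: (boolP (matching _)) => //= mG.
  by case: (boolP (matching _)) => //= mH; rewrite glueK// eqxx.
rewrite card_glue// -scalerAl -scalerAr scalerA -exprD -exprD; congr (_ *: 'X^_).
(* Subtraction is truncated: the exponents add because a matching with [k] edges needs [2 * k]
   vertices on its side. *)
rewrite card_sum mulnDr subnDA.
have := leq_card_matching mG; have := leq_card_matching mH.
move: #|M.1| #|M.2| => /= *. lia.
Qed.
End Join.

Theorem theorem4p4 (R : realType) (G H : sgraph) :
  (num_perfect_matchings (gjoin G H))%:R =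
    gauss_inner (signed_matching_poly R (gcompl G))
                (signed_matching_poly R (gcompl H))
  /\
  ((gauss_inner (signed_matching_poly R (gcompl G))
                (signed_matching_poly R (gcompl H)))%:E =
    ((Num.sqrt (2 * pi))^-1)%:E *
    \int[@lebesgue_measure R]_t
      (expR (- (t ^+ 2 / 2)) * (signed_matching_poly R (gcompl G)).[t]
                             * (signed_matching_poly R (gcompl H)).[t])%:E)%E.
Proof.
split; first by rewrite gauss_innerE signed_matching_poly_join perfect_matchings_gauss_mean.
(* [Rintegral] applies [fine] to the integral, which loses nothing because integrability makes the
   value finite. *)
rewrite /gauss_inner EFinM /Rintegral fineK//.
apply: integrable_fin_num => //.
have := integrable_gauss_poly
  (signed_matching_poly R (gcompl G) * signed_matching_poly R (gcompl H)).
apply: eq_integrable => //.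
by move=> t _ /=; rewrite hornerM mulrA.
Qed.
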